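(* Let $X$ be a compact space of finite covering dimension with a free $\mathbb{Z}_2$-action given by an involution $\sigma$ (so $\sigma\circ\sigma=\mathrm{id}_X$ and $\sigma(x)\neq x$ for all $x\in X$). Let $\Sigma X$ be the non-reduced suspension of $X$ and let $\Gamma X$ be the cone of $X$, with boundary $\partial(\Gamma X)=\{[(\tfrac12,x)] : x\in X\}$ identified with $X$. Then: (i) There is no $\mathbb{Z}_2$-equivariant continuous map $f\colon\Sigma X\to X$, where the $\mathbb{Z}_2$-action on $\Sigma X$ is given by the involution $[(t,x)]\mapsto[(1-t,\sigma(x))]$. (ii) There is no continuous map $g\colon\Gamma X\to X$ that is $\mathbb{Z}_2$-equivariant on $\partial(\Gamma X)=X$, i.e. such that $g([(\tfrac12,\sigma(x))])=\sigma(g([(\tfrac12,x)]))$ for all $x\in X$. Moreover, the conditions (i) and (ii) are equivalent; that is, a map $f$ as in (i) exists if and only if a map $g$ as in (ii) exists.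
   Context: The non-reduced suspension $\Sigma X$ is the quotient of $[0,1]\times X$ by the equivalence relation generated by $(0,x)\sim(0,x')$ and $(1,x)\sim(1,x')$ for all $x,x'\in X$. The cone $\Gamma X$ is the quotient of $[0,\tfrac12]\times X$ by the equivalence relation generated by $(0,x)\sim(0,x')$ for all $x,x'\in X$. Square brackets denote equivalence classes. A map between spaces with $\mathbb{Z}_2$-actions is called $\mathbb{Z}_2$-equivariant if it commutes with the given involutions.
   Formalization: ''Compact space'' is read as nonempty compact Hausdorff space: the claim fails for the empty space (empty maps are equivariant) and for the two-point indiscrete space with the swap (every equivariant map into it is continuous). *)

(* Defs.v *)
From HB Require Import structures.
From Stdlib Require Import Relation_Operators.
From mathcomp Require Import all_boot all_order all_algebra generic_quotient.
From mathcomp Require Import all_classical all_reals topology normedtype.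

Set Implicit Arguments.
Unset Strict Implicit.
Unset Printing Implicit Defensive.

Import Order.TTheory GRing.Theory Num.Theory.
Import numFieldNormedType.Exports.
Local Open Scope classical_set_scope.
Local Open Scope ring_scope.
Local Open Scope quotient_scope.

(* The library's [compact] does not include separation; here "compact space"
   means compact Hausdorff space. *)
Definition compact_hausdorff (X : topologicalType) : Prop :=
  compact [set: X] /\ hausdorff_space X.

Definition open_cover (X : topologicalType) (U : set (set X)) : Prop :=
  U `<=` open /\ cover U id = [set: X].

Definition refines (X : Type) (V U : set (set X)) : Prop :=
  forall B, V B -> exists2 A, U A & B `<=` A.

(* Lebesgue covering dimension: dim X <= n iff every open cover has an open
   refinement such that no point lies in more than n + 1 of its members. *)
Definition covering_dim_le (X : topologicalType) (n : nat) : Prop :=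
  forall U : set (set X), open_cover U ->
  exists V : set (set X),
    [/\ open_cover V, refines V U &
        forall x : X, ([set B | V B /\ B x] #<= `I_n.+1)%card].

Definition finite_covering_dim (X : topologicalType) : Prop :=
  exists n, covering_dim_le X n.

Definition free_Z2_action (X : topologicalType) (sigma : X -> X) : Prop :=
  [/\ continuous sigma, involutive sigma & forall x, sigma x <> x].

Definition Z2_equivariant (Y X : Type) (tau : Y -> Y) (sigma : X -> X)
    (f : Y -> X) : Prop :=
  forall y, f (tau y) = sigma (f y).

Section GeneratedQuotient.
Context {T : topologicalType} (r : T -> T -> Prop).

Let generated (x y : T) : bool := `[< clos_refl_sym_trans T r x y >].

Local Lemma generated_refl : reflexive generated.
Proof. by move=> x; apply/asboolP; exact: rst_refl. Qed.

Local Lemma generated_sym : symmetric generated.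
Proof. by move=> x y; apply/asboolP/asboolP; exact: rst_sym. Qed.

Local Lemma generated_trans : transitive generated.
Proof.
by move=> y x z /asboolP xy /asboolP yz; apply/asboolP; exact: rst_trans xy yz.
Qed.

Definition generated_equiv :=
  EquivRel generated generated_refl generated_sym generated_trans.

Definition gen_quot : Type := {eq_quot generated_equiv}.

HB.instance Definition _ := Topological.copy gen_quot (quotient_topology gen_quot).
HB.instance Definition _ := Quotient.on gen_quot.

Definition gen_class (x : T) : gen_quot := \pi_gen_quot x.

Lemma gen_class_eqP x y :
  gen_class x = gen_class y <-> clos_refl_sym_trans T r x y.
Proof.
rewrite /gen_class; split; first by move/eqmodP/asboolP.
by move=> h; apply/eqmodP/asboolP.
Qed.

Lemma gen_class_reprK (p : gen_quot) : gen_class (repr p) = p.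
Proof. exact: reprK. Qed.

Lemma gen_class_continuous : continuous gen_class.
Proof. exact: pi_continuous. Qed.

Lemma gen_quot_continuous (Z : topologicalType) (f : gen_quot -> Z) :
  continuous f <-> continuous (f \o gen_class).
Proof. exact: quotient_continuous. Qed.

End GeneratedQuotient.

Section SuspensionCone.
Variables (R : realType) (X : topologicalType).

Definition unit_itv : set R := `[0, 1]%classic.
Definition half_itv : set R := `[0, 2^-1]%classic.

Definition susp_glue (p q : unit_itv * X) : Prop :=
  (\val p.1 = 0 /\ \val q.1 = 0) \/ (\val p.1 = 1 /\ \val q.1 = 1).

Definition suspension : Type := gen_quot susp_glue.
HB.instance Definition _ := Topological.on suspension.

Definition susp_class (t : unit_itv) (x : X) : suspension :=
  gen_class susp_glue (t, x).

Definition cone_glue (p q : half_itv * X) : Prop :=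
  \val p.1 = 0 /\ \val q.1 = 0.

Definition cone : Type := gen_quot cone_glue.
HB.instance Definition _ := Topological.on cone.

Definition cone_class (t : half_itv) (x : X) : cone :=
  gen_class cone_glue (t, x).

Lemma flip_subproof (t : unit_itv) : (1 - \val t) \in unit_itv.
Proof.
have : unit_itv (\val t) := set_mem (valP t).
rewrite /unit_itv /= in_itv/= => /andP[t0 t1].
by apply/mem_set; rewrite /= in_itv/= subr_ge0 t1 lerBlDr lerDl.
Qed.

Definition unit_flip (t : unit_itv) : unit_itv :=
  exist (fun s => s \in unit_itv) (1 - \val t) (flip_subproof t).

Lemma half_subproof : (2^-1 : R) \in half_itv.
Proof. by apply/mem_set; rewrite /half_itv/= in_itv/= invr_ge0 ler0n lexx. Qed.

Definition half_pt : half_itv :=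
  exist (fun s => s \in half_itv) 2^-1 half_subproof.

(* The boundary inclusion X -> Cone X, whose image is the boundary. *)
Definition cone_base (x : X) : cone := cone_class half_pt x.

Definition susp_flip (sigma : X -> X) (p : suspension) : suspension :=
  susp_class (unit_flip (repr p).1) (sigma (repr p).2).

(* [susp_flip] does not depend on the chosen representatives. *)
Lemma susp_flipE (sigma : X -> X) t x :
  susp_flip sigma (susp_class t x) = susp_class (unit_flip t) (sigma x).
Proof.
pose F (p : unit_itv * X) := (unit_flip p.1, sigma p.2).
suff H p q : clos_refl_sym_trans _ susp_glue p q ->
    clos_refl_sym_trans _ susp_glue (F p) (F q).
  rewrite /susp_flip /susp_class; apply/gen_class_eqP.
  by apply: (H _ (t, x)); apply/gen_class_eqP; exact: gen_class_reprK.
elim=> {p q} [p q pq|p|p q _|p q s _ + _]; last 3 first.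
- exact: rst_refl.
- exact: rst_sym.
- exact: rst_trans.
apply: rst_step; rewrite /susp_glue/=.
by case: pq => -[-> ->]; [right; rewrite subr0|left; rewrite subrr].
Qed.

End SuspensionCone.

Arguments susp_flip R {X} sigma p.
Arguments cone_base R {X} x.

(* Main.v *)
From Stdlib Require Import Relation_Operators.
Require Import Defs.
From mathcomp Require Import all_boot all_order all_algebra.
From mathcomp Require Import all_classical all_reals topology normedtype.

Set Implicit Arguments.
Unset Strict Implicit.
Unset Printing Implicit Defensive.

Import Order.TTheory GRing.Theory Num.Theory.
Import numFieldNormedType.Exports.
Local Open Scope classical_set_scope.

(** Both (i) and (ii) yield a null-homotopic map [phi : X -> X] commuting with
    [sigma]; this is impossible by a Ky Fan type parity argument on "small"
    tuples of points, with coefficients mod 2.  From a chain [c] of small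
    tuples such that [c + sigma c] is a cycle, the prism operator of the
    homotopy builds a chain [c'] one dimension higher with boundary
    [phi (c + sigma c)]: the other end of the homotopy contributes nothing,
    because a constant map sends [c] and [sigma c] to the same chain.  Now
    label the points by [+-1, ..., +-m], oddly under [sigma], with no two
    opposite labels in a small tuple.  As in Fan's lemma, the parity of the
    number of tuples with alternating labels is the same for [c] and [c'].  It
    is odd for a single point, yet [m + 1] points cannot carry alternating
    labels with [m] distinct absolute values.  Such a labelling comes from a
    finite cover by sets [C] with [C] and [sigma C] disjoint. *)

(** * Mod 2 cochains and the prism operator *)

(* A cochain mod 2 is a boolean function on tuples, and [(+)] is addition.  The
   complex is augmented: the empty tuple is the (-1)-simplex. *)
Fixpoint coboundary (T : Type) (p : seq T -> bool) (s : seq T) : bool :=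
  if s is x :: s' then p s' (+) coboundary (p \o cons x) s' else false.

Lemma coboundary_map (S T : Type) (h : S -> T) p s :
  coboundary (p \o map h) s = coboundary p (map h s).
Proof.
elim: s p => //= x s IH p; congr (_ (+) _); exact: (IH (p \o cons (h x))).
Qed.

Section Cochains.
Variable T : eqType.
Implicit Types (p q : seq T -> bool) (s t : seq T) (f g : T -> T).

(** Transpose of the prism operator: the sum of [p] over the tuples
    [f x_0, ..., f x_i, g x_i, ..., g x_k]. *)
Fixpoint prism f g p s : bool :=
  if s is x :: s' then
    p [:: f x, g x & map g s'] (+) prism f g (p \o cons (f x)) s'
  else false.

Lemma eq_coboundary p q s : p =1 q -> coboundary p s = coboundary q s.
Proof.
elim: s p q => //= x s IH p q pq; rewrite pq (IH _ (q \o cons x))// => t.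
exact: pq.
Qed.

Lemma coboundaryD p q s :
  coboundary (fun t => p t (+) q t) s = coboundary p s (+) coboundary q s.
Proof.
elim: s p q => //= x s IH p q.
by rewrite (IH (p \o cons x) (q \o cons x)) addbACA.
Qed.

Lemma coboundary_false s : coboundary (fun=> false) s = false.
Proof. by elim: s. Qed.

Lemma eq_in_prism f g p q s (U : T -> Prop) :
  (forall x, x \in s -> U (f x) /\ U (g x)) ->
  (forall t, size t = (size s).+1 -> (forall x, x \in t -> U x) -> p t = q t) ->
  prism f g p s = prism f g q s.
Proof.
elim: s p q => //= x s IH p q Us pq.
have [Ufx Ugx] := Us x (mem_head _ _).
congr (_ (+) _).
  apply: pq; first by rewrite /= size_map.
  move=> y; rewrite !inE => /or3P[/eqP->|/eqP->|]//.
  by case/mapP=> z zs ->; apply: (Us z _).2; rewrite inE zs orbT.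
apply: IH => [y ys|t st Ut]; first by apply: Us; rewrite inE ys orbT.
by apply: pq => [|y]; rewrite /= ?st// inE => /predU1P[->|/Ut].
Qed.

Lemma eq_prism f g p q s : p =1 q -> prism f g p s = prism f g q s.
Proof. by move=> pq; apply: (@eq_in_prism _ _ _ _ _ (fun=> True)). Qed.

Lemma prismD f g p q s :
  prism f g (fun t => p t (+) q t) s = prism f g p s (+) prism f g q s.
Proof.
elim: s p q => //= x s IH p q.
by rewrite (IH (p \o cons (f x)) (q \o cons (f x))) addbACA.
Qed.

(** The chain homotopy formula from [f] to [g], without signs mod 2: faces shared by consecutive
    prism simplices occur twice and cancel. *)
Lemma prism_coboundary f g p s :
  prism f g (coboundary p) s =
  coboundary (prism f g p) s (+) p (map f s) (+) p (map g s).
Proof.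
elim: s p => [|x s IH] p /=; first by case: (p _).
rewrite (@eq_prism _ _ (coboundary p \o cons (f x))
  (fun t => p t (+) coboundary (p \o cons (f x)) t))// prismD IH.
rewrite (@eq_coboundary (prism f g p \o cons x)
  (fun t => (p \o cons (f x) \o cons (g x) \o map g) t (+)
            prism f g (p \o cons (f x)) t))// coboundaryD.
rewrite (coboundary_map g (p \o cons (f x) \o cons (g x))) /=.
have xorE u v w x1 x2 x3 : u (+) (v (+) w) (+) (x1 (+) (x2 (+) x3 (+) v)) =
    x1 (+) (w (+) x2) (+) x3 (+) u.
  by case: u; case: v; case: w; case: x1; case: x2; case: x3.
exact: xorE.
Qed.

End Cochains.

(** * Alternating labels and Fan's parity identity *)

Section Alternating.
Implicit Types (x y : nat * bool) (s t : seq (nat * bool)).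

(** A pair [(i, b)] encodes the label of absolute value [i + 1] and sign [b]. *)
Definition neg_label x := (x.1, ~~ x.2).

Definition noncomplementary s :=
  forall x y, x \in s -> y \in s -> x.1 = y.1 -> x = y.

Fixpoint alternating_from c b s : bool :=
  if s is x :: s' then
    [&& c <= x.1, x.2 == b & alternating_from x.1.+1 (~~ b) s']
  else true.

Fixpoint insert x s :=
  if s is y :: s' then if x.1 <= y.1 then x :: s else y :: insert x s'
  else [:: x].

Fixpoint label_sort s := if s is x :: s' then insert x (label_sort s') else [::].

(* Sorting makes the condition independent of the order of the vertices; without
   it [coboundary_alternating] would fail. *)
Definition alternating s := alternating_from 0 true (label_sort s).

Local Notation sorted := (sorted (relpre fst leq)).

Lemma insert_min x s : all (fun y => x.1 <= y.1) s -> insert x s = x :: s.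
Proof. by case: s => //= y s /andP[->]. Qed.

Lemma mem_insert x s : insert x s =i x :: s.
Proof.
elim: s => //= y s IH z; case: ifP => // _.
by rewrite inE IH !inE orbCA.
Qed.

Lemma mem_label_sort s : label_sort s =i s.
Proof. by elim: s => //= x s IH z; rewrite mem_insert !inE IH. Qed.

Lemma size_label_sort s : size (label_sort s) = size s.
Proof.
elim: s => //= x s <-; elim: (label_sort s) => //= y t IH.
by case: ifP => //= _; rewrite IH.
Qed.

Lemma map_neg_insert x s :
  map neg_label (insert x s) = insert (neg_label x) (map neg_label s).
Proof. by elim: s => //= y s IH; case: ifP => //= _; rewrite IH. Qed.

Lemma label_sort_neg s :
  label_sort (map neg_label s) = map neg_label (label_sort s).
Proof. by elim: s => //= x s ->; rewrite map_neg_insert. Qed.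

Lemma key_trans : transitive (relpre fst leq : rel (nat * bool)).
Proof. by move=> y x z /=; exact: leq_trans. Qed.

Lemma insert_sorted x s : sorted s -> sorted (insert x s).
Proof.
elim: s => //= y s IH ys; case: ifP => [xy|/negbT]; first by rewrite /= xy.
rewrite -ltnNge => yx; move: ys; rewrite /= !path_sortedE; try exact: key_trans.
case/andP=> /allP ys /IH ->; rewrite andbT; apply/allP => z.
by rewrite mem_insert inE => /predU1P[->|/ys]//=; exact: ltnW.
Qed.

Lemma label_sort_sorted s : sorted (label_sort s).
Proof. by elim: s => //= x s; exact: insert_sorted. Qed.

Lemma eq_in_coboundary_sub (p q : seq (nat * bool) -> bool) s :
  (forall t, {subset t <= s} -> p t = q t) -> coboundary p s = coboundary q s.
Proof.
elim: s p q => //= x s IH p q pq; rewrite pq; last first.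
  by move=> z zs; rewrite inE zs orbT.
congr (_ (+) _); apply: IH => t ts; apply: pq => z; rewrite !inE.
by case/predU1P=> [->|/ts ->]; rewrite ?eqxx ?orbT.
Qed.

(** A face of [insert x s] either omits [x] or is a face of [s] with [x] inserted; mod 2 the
    position of [x] costs no sign. *)
Lemma coboundary_insert p x s : sorted s ->
  coboundary p (insert x s) = p s (+) coboundary (p \o insert x) s.
Proof.
elim: s p => //= y s IH p ys; case: ifP => [xy|/negbT].
  rewrite /=; congr (_ (+) _).
  apply: (eq_in_coboundary_sub (s := y :: s)) => t tys /=; rewrite insert_min//.
  apply/allP => z /tys; rewrite inE => /predU1P[->//|zs].
  have /allP/(_ z zs) /= := order_path_min key_trans ys.
  exact: leq_trans.
rewrite -ltnNge => yx /=; rewrite IH; last exact: path_sorted ys.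
have -> : coboundary (p \o insert x \o cons y) s =
    coboundary (p \o cons y \o insert x) s.
  by apply: eq_coboundary => t /=; rewrite leqNgt yx.
by rewrite addbCA.
Qed.

Lemma coboundary_label_sort p s :
  coboundary (p \o label_sort) s = coboundary p (label_sort s).
Proof.
elim: s p => //= x s IH p.
rewrite coboundary_insert; last exact: label_sort_sorted.
by congr (_ (+) _); rewrite -IH.
Qed.

Lemma noncomplementary_cons x s :
  noncomplementary (x :: s) -> noncomplementary s.
Proof. by move=> h y z ys zs; apply: h; rewrite inE ?ys ?zs orbT. Qed.

(** A nonempty tuple alternating from [b] has one face of that kind, omitting its last entry; one
    alternating from [~~ b] also has one, omitting its first. In any other tuple such faces pair
    off, omitting one or the other of two neighbours of equal sign. *)
Lemma coboundary_alternating_from c b s :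
  sorted s -> noncomplementary s -> all (fun y => c <= y.1) s ->
  coboundary (alternating_from c b) s =
  alternating_from c b s (+) alternating_from c (~~ b) s.
Proof.
elim: s c b => //= x s IH c b xs nc /andP[cx cs].
rewrite cx /=.
rewrite (@eq_coboundary _ _
  (fun t => (x.2 == b) && alternating_from x.1.+1 (~~ b) t)); last first.
  by move=> t /=; rewrite cx.
have min_x := order_path_min key_trans xs.
have {}IH c' b' : all (fun y => c' <= y.1) s ->
    coboundary (alternating_from c' b') s =
    alternating_from c' b' s (+) alternating_from c' (~~ b') s.
  by apply: IH; [exact: path_sorted xs|exact: noncomplementary_cons nc].
case: s xs nc min_x cs IH => [|y s] /=.
  by move=> _ _ _ _ _; case: (x.2); case: b.
move=> /andP[xy ys] nc /andP[_ min_x] /andP[cy cs] IH.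
have min_y := order_path_min key_trans ys.
(* In a tie [y = x], so the faces omitting either coincide and cancel; every other face keeps both
   and does not alternate. *)
have [yx|ltxy] := leqP y.1 x.1.
  have e : y = x.
    apply: nc; rewrite ?inE ?eqxx ?orbT//.
    by apply/eqP; rewrite eqn_leq yx.
  rewrite e cx /= !andbF /=.
  have [xb|xb] := eqVneq x.2 b; rewrite /=.
    rewrite (@eq_coboundary _ _ (fun=> false) s); last first.
      by move=> t /=; rewrite ltnn.
    by rewrite coboundary_false; case: alternating_from.
  exact: coboundary_false.
have all_y d : d <= y.1 -> all (fun z => d <= z.1) s.
  move=> dy; apply/allP => z /(allP min_y) /=; exact: leq_trans.
have := IH x.1.+1 (~~ b); rewrite /= ltxy cy /= all_y// => /(_ isT) IH'.
(* If [x] has sign [b], the faces keeping [x] are counted by induction on the tail; otherwise only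
   the face omitting [x] can start with sign [b]. *)
have [xb|xb] := eqVneq x.2 b; rewrite /=.
  have bF : (b == ~~ b) = false by case: (b).
  by rewrite IH' xb bF !negbK /= addbF addbCA addbb addbF.
have -> : coboundary (xpred0 \o cons y) s = false by exact: coboundary_false.
have -> : x.2 = ~~ b by case: (x.2) xb; case: (b).
by rewrite eqxx !negbK addbF.
Qed.

Lemma alternating_from_neg c b s :
  alternating_from c b (map neg_label s) = alternating_from c (~~ b) s.
Proof.
elim: s c b => //= x s IH c b; rewrite IH; congr [&& _, _ & _].
by case: (x.2); case: b.
Qed.

(** Sorting commutes with taking faces, and negation exchanges the two starting signs. *)
Lemma coboundary_alternating s : noncomplementary s ->
  coboundary alternating s =
  alternating s (+) alternating (map neg_label s).
Proof.
move=> nc; rewrite coboundary_label_sort coboundary_alternating_from.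
- by rewrite /alternating label_sort_neg alternating_from_neg.
- exact: label_sort_sorted.
- by move=> x y; rewrite !mem_label_sort; exact: nc.
- exact/allP.
Qed.

Lemma alternating_from_size m c b s :
  all (fun x => x.1 < m) s -> alternating_from c b s -> c <= m ->
  c + size s <= m.
Proof.
elim: s c b => [|x s IH] c b /=; first by rewrite addn0.
case/andP=> xm sm /and3P[cx _ h] _.
by apply: leq_trans (IH _ _ sm h xm); rewrite addSnnS leq_add2r ?ltnS.
Qed.

Lemma alternating_size m s :
  all (fun x => x.1 < m) s -> alternating s -> size s <= m.
Proof.
move=> sm h; rewrite -(size_label_sort s) -[size _]add0n.
apply: alternating_from_size h _ => //.
by apply/allP => x; rewrite mem_label_sort => /(allP sm).
Qed.

End Alternating.

(** * Prisms along a sequence of maps *)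

Fixpoint prisms (T : eqType) (h : nat -> T -> T) n (p : seq T -> bool) s :=
  if n is m.+1 then prisms h m p s (+) prism (h m) (h m.+1) p s else false.

Section Prisms.
Variables (T : eqType) (h : nat -> T -> T).

Lemma prismsD n p q s :
  prisms h n (fun t => p t (+) q t) s = prisms h n p s (+) prisms h n q s.
Proof. by elim: n => //= n ->; rewrite prismD addbACA. Qed.

(** Telescoping: the end of each prism cancels the start of the next. *)
Lemma prisms_coboundary n p s :
  prisms h n (coboundary p) s =
  coboundary (prisms h n p) s (+) p (map (h 0) s) (+) p (map (h n) s).
Proof.
elim: n => [|n IH]; last rewrite /=.
  have -> : coboundary (prisms h 0 p) s = false by exact: coboundary_false.
  by rewrite addFb addbb.
rewrite coboundaryD IH prism_coboundary.
have xorE u v w x y : u (+) v (+) w (+) (x (+) w (+) y) = u (+) x (+) v (+) y.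
  by case: u; case: v; case: w; case: x; case: y.
exact: xorE.
Qed.

(** Only tuples between two consecutive maps enter, so knowing a cochain on small tuples will
    suffice. *)
Lemma eq_in_prisms n p q s :
  (forall i t, i < n -> size t = (size s).+1 ->
     {subset t <= map (h i) s ++ map (h i.+1) s} -> p t = q t) ->
  prisms h n p s = prisms h n q s.
Proof.
elim: n => //= n IH pq; congr (_ (+) _).
  by apply: IH => i t /ltnW; exact: pq.
apply: (@eq_in_prism _ _ _ _ _ _
  (fun x => x \in map (h n) s ++ map (h n.+1) s)) => [x xs|t st ts].
  by split; rewrite mem_cat map_f// orbT.
exact: (pq n).
Qed.

End Prisms.

(** * Parity of alternating tuples on symmetrized chains *)

Section OddFunctionals.
Variables (X : topologicalType) (sigma : X -> X).
Hypotheses (sigma_cont : continuous sigma) (sigmaK : involutive sigma).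
Implicit Types (U V W : X -> set X) (p q : seq X -> bool) (s : seq X).

Definition nbhs_cover W := forall x, nbhs x (W x).

Definition small W s := exists z, forall x, x \in s -> W z x.

(** The second clause excludes opposite labels in a [W]-small tuple. *)
Definition odd_labelling W (l : X -> nat * bool) :=
  (forall x, l (sigma x) = neg_label (l x)) /\
  forall z x y, W z x -> W z y -> (l x).1 = (l y).1 -> l x = l y.

Definition symmetrize p s := p s (+) p (map sigma s).

(* [L] is evaluation of cochains mod 2 on a chain of [W]-small [k]-simplices,
   i.e. (k+1)-tuples; [symmetrize] is the transpose of [c |-> c + sigma c]. *)
Record odd_functional W k (L : (seq X -> bool) -> bool) : Prop := {
  functionalD : forall p q, L (fun s => p s (+) q s) = L p (+) L q;
  functional_small : forall p q,
    (forall s, size s = k.+1 -> small W s -> p s = q s) -> L p = L q;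
  functional_cycle : forall p, L (symmetrize (coboundary p)) = false;
  functional_alternating : forall l, odd_labelling W l ->
    L (symmetrize (alternating \o map l)) = true }.

Lemma functional0 W k L : odd_functional W k L -> L (fun=> false) = false.
Proof.
move=> oL; have := functionalD oL (fun=> false) (fun=> false).
by rewrite /=; case: (L _).
Qed.

Lemma odd_labelling_map (l : X -> nat * bool) s :
  (forall x, l (sigma x) = neg_label (l x)) ->
  map l (map sigma s) = map neg_label (map l s).
Proof. by move=> lodd; rewrite -!map_comp; apply: eq_map => x /=. Qed.

(** Base case: the augmentations of [x] and [sigma x] cancel mod 2, and exactly one of their
    opposite labels has sign [true]. *)
Lemma odd_functional0 W x : nbhs_cover W ->
  odd_functional W 0 (fun p => p [:: x]).
Proof.
move=> cW; split => //.
- move=> p q; apply => //; exists x => y; rewrite inE => /eqP ->.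
  exact: nbhs_singleton.
- by move=> p; rewrite /symmetrize /=; case: (p _).
- move=> l [lodd _]; rewrite /symmetrize /= lodd /alternating /=.
  by case: (l x).2.
Qed.

Lemma symmetrizeK p s : symmetrize p (map sigma s) = symmetrize p s.
Proof. by rewrite /symmetrize (mapK sigmaK) addbC. Qed.

Lemma symmetrize_coboundary p s :
  symmetrize (coboundary p) s = coboundary (symmetrize p) s.
Proof.
by rewrite /symmetrize coboundaryD -(coboundary_map sigma).
Qed.

Lemma symmetrize_map (f : X -> X) p s :
  (forall x, f (sigma x) = sigma (f x)) ->
  symmetrize p (map f s) = symmetrize (p \o map f) s.
Proof.
move=> fs; rewrite /symmetrize /=; congr (_ (+) p _).
by rewrite -!map_comp; apply: eq_map => x /=; rewrite fs.
Qed.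

(** A sampled homotopy from a constant map to an equivariant one; the last clause makes the prisms
    over [W]-small tuples [V]-small. *)
Definition fine_homotopy (h : nat -> X -> X) n W V :=
  [/\ forall x y, h 0 x = h 0 y,
      forall x, h n.+1 (sigma x) = sigma (h n.+1 x) &
      forall i z, i <= n ->
        exists z', forall y, W z y -> V z' (h i y) /\ V z' (h i.+1 y)].

Lemma symmetrize_small W V s :
  (forall z y, V z y -> W z y /\ W (sigma z) (sigma y)) ->
  small V s -> small W s /\ small W (map sigma s).
Proof.
move=> VW [z Vz]; split; first by exists z => x /Vz /VW[].
by exists (sigma z) => _ /mapP[x /Vz /VW[] _ + ->].
Qed.

Lemma odd_functionalS h n U V W k L : fine_homotopy h n V U ->
  (forall z y, W z y -> V z y /\ V (sigma z) (sigma y)) ->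
  odd_functional W k L ->
  odd_functional U k.+1 (fun p => L (symmetrize (prisms h n.+1 p))).
Proof.
move=> [hc he hf] WV oL.
have small_prisms p q : (forall s, size s = k.+2 -> small U s -> p s = q s) ->
    forall s, size s = k.+1 -> small W s ->
    symmetrize (prisms h n.+1 p) s = symmetrize (prisms h n.+1 q) s.
  move=> pq; have pqV s : size s = k.+1 -> small V s ->
      prisms h n.+1 p s = prisms h n.+1 q s.
    move=> sk [z Vz]; apply: eq_in_prisms => i t ilt st ts.
    apply: pq; first by rewrite st sk.
    have [z' Uz'] := hf i z ilt; exists z' => x /ts.
    by rewrite mem_cat => /orP[] /mapP[y /Vz/Uz'[? ?] ->].
  move=> s sk /(symmetrize_small WV)[Vs Vss].
  by rewrite /symmetrize !pqV// size_map.
(* The boundary of the new chain is the image under [h n.+1] of the old symmetrized chain: the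
   latter is a cycle, and the end at the constant map [h 0] cancels. *)
have prisms_cycle p :
    L (symmetrize (prisms h n.+1 (coboundary p))) =
    L (symmetrize (p \o map (h n.+1))).
  rewrite (_ : symmetrize (prisms _ _ _) = fun s =>
      symmetrize (coboundary (prisms h n.+1 p)) s (+)
      symmetrize (p \o map (h n.+1)) s).
    by rewrite (functionalD oL) (functional_cycle oL).
  apply/funext => s; rewrite /symmetrize !prisms_coboundary /=.
  have -> : map (h 0) (map sigma s) = map (h 0) s.
    by rewrite -map_comp; apply: eq_map => x /=; exact: hc.
  have xorE u v w x y :
      u (+) v (+) w (+) (x (+) v (+) y) = u (+) x (+) (w (+) y).
    by case: u; case: v; case: w; case: x; case: y.
  exact: xorE.
split.
- move=> p q; rewrite -(functionalD oL); congr (L _); apply/funext => s.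
  by rewrite /symmetrize !prismsD addbACA.
- by move=> p q pq; apply: (functional_small oL); exact: small_prisms.
(* [h n.+1] commutes with [sigma], and symmetrizing twice gives zero mod 2. *)
- move=> p; rewrite (_ : symmetrize (coboundary p) = coboundary (symmetrize p));
    last by apply/funext => s; rewrite symmetrize_coboundary.
  rewrite prisms_cycle -(functional0 oL); congr (L _); apply/funext => s.
  by rewrite -symmetrize_map// /symmetrize -/(symmetrize p _)
    -/(symmetrize p _) symmetrizeK addbb.
- move=> l [lodd lU].
  (* On small tuples Fan's identity turns the symmetrized alternating cochain into a coboundary,
     moving the count to [h n.+1]. *)
  rewrite (functional_small oL (q := symmetrize (prisms h n.+1
    (coboundary (alternating \o map l))))); last first.
    apply: small_prisms => s _ [z Uz].
    rewrite coboundary_map coboundary_alternating /symmetrize /=.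
      by rewrite odd_labelling_map.
    move=> _ _ /mapP[x /Uz Ux ->] /mapP[y /Uz Uy ->]; exact: lU Ux Uy.
  rewrite prisms_cycle -[RHS](functional_alternating oL (l := l \o h n.+1)).
    by congr (L (symmetrize _)); apply/funext => s; rewrite /= map_comp.
  split=> [x|z x y Wx Wy]; first by rewrite /= he lodd.
  have [z' Uz'] := hf n z (leqnn n).
  apply: (lU z'); first exact: (Uz' _ (WV _ _ Wx).1).2.
  exact: (Uz' _ (WV _ _ Wy).1).2.
Qed.

Lemma exists_odd_functional (x : X) :
  (forall W, nbhs_cover W ->
    exists V : X -> set X, exists h n, nbhs_cover V /\ fine_homotopy h n V W) ->
  forall k W, nbhs_cover W -> exists L, odd_functional W k L.
Proof.
move=> fine; elim=> [|k IH] W cW.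
  by exists (fun p => p [:: x]); exact: odd_functional0.
have [V [h [n [cV hf]]]] := fine W cW.
(* The preimage makes [map sigma s] small for [V] along with [s]. *)
pose V' z := V z `&` sigma @^-1` V (sigma z).
have [|L oL] := IH V'.
  by move=> z; apply: filterI; [exact: cV|apply: sigma_cont; exact: cV].
by eexists; apply: odd_functionalS hf _ oL.
Qed.

(** In dimension [m] a tuple has one point more than there are absolute values, so the count that
    must be odd is zero. *)
Lemma no_odd_labelling (x : X) m W (l : X -> nat * bool) :
  (forall V, nbhs_cover V ->
    exists U : X -> set X, exists h n, nbhs_cover U /\ fine_homotopy h n U V) ->
  nbhs_cover W -> odd_labelling W l -> ~ (forall y, (l y).1 < m).
Proof.
move=> fine cW ol lm; have [L oL] := exists_odd_functional x fine m cW.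
have := functional_alternating oL ol.
rewrite (functional_small oL (q := fun=> false)) ?(functional0 oL)//.
suff alt0 s : size s = m.+1 -> alternating (map l s) = false.
  by move=> s sm _; rewrite /symmetrize /= !alt0// size_map.
move=> sm; apply/negP => /(alternating_size (m := m)).
rewrite size_map sm ltnn => /(_ _)/notF; apply.
by apply/allP => _ /mapP[y _ ->].
Qed.

End OddFunctionals.

(** * Odd labellings of a compact space with a free involution *)

Lemma compact_finite_nbhs_cover (X : topologicalType) (C : X -> set X) :
  compact [set: X] -> nbhs_cover C ->
  exists D : seq X, forall y, exists2 x, x \in D & C x y.
Proof.
move=> /compact_near_coveringP cX cC.
(* Finite lists are filtered by inclusion: lists containing [x] serve all points near [x], and
   compactness yields one list for all points. *)
pose F : set_system (seq X) :=
  filter_from setT (fun D0 : seq X => [set D : seq X | {subset D0 <= D}]).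
have FF : ProperFilter F.
  apply: filter_from_proper => [|D _]; last by exists D => x.
  apply: filter_from_filter; first by exists [::].
  move=> D1 D2 _ _; exists (D1 ++ D2) => // D sub; split=> x xD.
    by apply: sub; rewrite mem_cat xD.
  by apply: sub; rewrite mem_cat xD orbT.
have /filter_ex[D h] : \near F, [set: X] `<=` fun y => exists2 x, x \in F & C x y.
  apply: cX => x _.
  exists (C x, [set D : seq X | {subset [:: x] <= D}]).
    by split; [exact: cC|exists [:: x]].
  move=> [y D] /= [Cxy xD]; exists x => //; apply: xD; exact: mem_head.
by exists D => y; exact: h.
Qed.

Section FreeCompact.
Variables (X : topologicalType) (sigma : X -> X).
Hypotheses (X_compact : compact_hausdorff X) (sigma_free : free_Z2_action sigma).

(** Separate [x] and [sigma x] by disjoint open [A] and [B]; by regularity the points of [A] sent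
    into [B] contain a closed neighbourhood of [x]. *)
Lemma free_closed_nbhs (x : X) :
  exists C, [/\ nbhs x C, closed C & forall y, C y -> ~ C (sigma y)].
Proof.
have [cX hX] := X_compact; have [cs sK sx] := sigma_free.
move: hX; rewrite open_hausdorff => /(_ x (sigma x)) [].
  by apply/eqP => e; exact: (sx x).
move=> [A B] /= [/set_mem xA /set_mem sxB] [oA oB /eqP AB0].
have /(compact_regular (proj2 X_compact) cX (filterT : nbhs x setT)) :
    nbhs x (A `&` sigma @^-1` B).
  apply: filterI; first exact: open_nbhs_nbhs.
  by apply: cs; exact: open_nbhs_nbhs.
case=> M xM MAB; exists (closure M); split.
- by apply: filterS xM; exact: subset_closure.
- exact: closed_closure.
- move=> y /MAB[_ /= By] /MAB[Ay _].
  by suff : set0 (sigma y) by []; rewrite -AB0.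
Qed.

(** With finitely many [C x] covering the space, the label of [y] records the first [x] such that
    [y] or [sigma y] lies in [C x]; its sign tells whether [y] does. *)
Lemma exists_odd_labelling : exists m W l,
  [/\ nbhs_cover W, odd_labelling sigma W l & forall y : X, (l y).1 < m].
Proof.
have [cX _] := X_compact; have [cs sK _] := sigma_free.
have [C hC] := choice free_closed_nbhs.
have [|D Dcov] := @compact_finite_nbhs_cover _ C cX.
  by move=> x; have [] := hC x.
have Cs x y : C x y -> ~ C x (sigma y) by have [_ _] := hC x; exact.
pose P y x := `[< C x y \/ C x (sigma y) >].
have Ps y : P (sigma y) =1 P y.
  by move=> x; rewrite /P sK; apply/asboolP/asboolP => -[]; auto.
have hasP y : has (P y) D.
  by have [x xD Cxy] := Dcov y; apply/hasP; exists x => //; apply/asboolP; left.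
pose d y := nth y D (find (P y) D).
have dD y : d y \in D by rewrite mem_nth// -has_find.
have Pd y : C (d y) y \/ C (d y) (sigma y) by exact/asboolP/(nth_find y (hasP y)).
have d_eq x y : find (P x) D = find (P y) D -> d x = d y.
  by move=> e; rewrite /d e; apply: set_nth_default; rewrite -has_find.
pose l y := (find (P y) D, `[< C (d y) y >]).
(* [W z] avoids those of the finitely many closed sets [C x], and their preimages under [sigma],
   that miss [z]; hence it is a neighbourhood of [z]. *)
pose W z := [set y | forall x, x \in D ->
  (C x y -> C x z) /\ (C x (sigma y) -> C x (sigma z))].
exists (size D), W, l; split.
- move=> z; rewrite /W; elim: D {Dcov hasP d dD Pd d_eq l W} => [|x D IH].
    exact: filterE.
  have near_notin (f : X -> X) : continuous f -> nbhs z [set y | C x (f y) -> C x (f z)].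
    move=> cf; have [Cz|nCz] := pselect (C x (f z)); first by apply: filterE => y.
    have nC : nbhs (f z) (~` C x).
      by apply: open_nbhs_nbhs; split=> //; apply: closed_openC; have [] := hC x.
    have nz : nbhs z (f @^-1` (~` C x)) by exact: cf.
    by apply: filterS nz => y nCy /nCy.
  apply: filterS (filterI (filterI (near_notin _ _) (near_notin _ cs)) IH).
    move=> y [[yx ysx] yD] x'; rewrite inE => /predU1P[->|/yD//].
    by split; [exact: yx|exact: ysx].
  by move=> ?; exact: cvg_id.
- split=> [y|z x y Wx Wy /= e].
    have e : find (P (sigma y)) D = find (P y) D by exact: eq_find.
    rewrite /l /neg_label /= e (d_eq _ _ e); congr pair.
    apply/asboolP/negP => [Cs' /asboolP /Cs|nC]; first exact.
    by have [Cy|//] := Pd y; case: nC; apply/asboolP.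
  rewrite /l /= e (d_eq _ _ e); congr pair.
  have := Pd x; rewrite (d_eq _ _ e) => Px.
  (* Opposite signs would put both [z] and [sigma z] into the same [C x]. *)
  apply/asboolP/asboolP => [Cx|Cy].
    have [//|Csy] := Pd y; have /Cs[] := (Wx _ (dD y)).1 Cx.
    exact: (Wy _ (dD y)).2.
  have [//|Csx] := Px; have /Cs[] := (Wy _ (dD y)).1 Cy.
  exact: (Wx _ (dD y)).2.
- by move=> y; rewrite /l /= -has_find.
Qed.

End FreeCompact.

(** * Sampling a homotopy finely enough *)

Section FineHomotopy.
Variables (R : realType) (X : topologicalType) (sigma : X -> X).
Variables (H : R * X -> X) (b : R).
Hypotheses (X_compact : compact [set: X]) (H_cont : continuous H).
Hypothesis b_ge0 : (0 <= b)%R.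
Hypothesis H0 : forall x y, H (0%R, x) = H (0%R, y).
Hypothesis Hb : forall x, H (b, sigma x) = sigma (H (b, x)).

Local Open Scope ring_scope.

(** A Lebesgue number in the time direction, by compactness of the product of [[0, b]] and [X]. *)
Lemma uniform_step (W : X -> set X) : nbhs_cover W -> exists2 d : R, 0 < d &
  forall (t : R) (x : X), 0 <= t <= b -> exists2 V, nbhs x V &
    exists z, forall s y, `|s - t| < d -> V y -> W z (H (s, y)).
Proof.
move=> cW.
pose P (d : R) (p : R * X) := exists2 V, nbhs p.2 V &
    exists z, forall s y, `|s - p.1| < d -> V y -> W z (H (s, y)).
have : compact (`[0, b]%classic `*` [set: X]).
  by apply: compact_setX => //; exact: segment_compact.
move/compact_near_coveringP => /(_ R (0^'+) P _) h.
have {}h : \forall d \near 0^'+, `[0, b]%classic `*` [set: X] `<=` P d.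
  apply: h => -[t x] _.
  have /H_cont : nbhs (H (t, x)) (W (H (t, x))) by exact: cW.
  case=> -[A B] /= [tA xB] AB.
  have [e e0 eA] : exists2 e : R, 0 < e & forall s, `|s - t| < e -> A s.
    have /nbhs_ballP[e /= e0 he] := tA; exists e => // s st.
    by apply: he; rewrite /ball/= distrC.
  (* Halving [e] leaves room for the triangle inequality through [s]. *)
  exists ((ball t (e / 2) `*` interior B), [set d : R | d < e / 2]).
    split; last by apply: nbhs_right_lt; rewrite divr_gt0.
    exists (ball t (e / 2), interior B); last by [].
    split; first by apply: nbhsx_ballx; rewrite divr_gt0.
    exact: nbhs_interior.
  move=> [[s y] d] /= [[ts By] de]; exists B; first exact: By.
  exists (H (t, x)) => s' y' s's By'; apply: (AB (s', y')); split => //=.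
  apply: eA; rewrite -(subrKA s) (le_lt_trans (ler_normD _ _))//.
  by rewrite (splitr e) ltrD// ?(lt_trans s's)// distrC.
have [d [d0 hd]] : exists d : R, 0 < d /\ `[0, b]%classic `*` [set: X] `<=` P d.
  apply: (@filter_ex _ (0^'+)); apply: filterI => //; exact: nbhs_right_gt.
by exists d => // t x tb; apply: (hd (t, x)); split => //=; rewrite in_itv.
Qed.

Lemma exists_fine_homotopy (W : X -> set X) : nbhs_cover W ->
  exists V : X -> set X, exists h n, nbhs_cover V /\ fine_homotopy sigma h n V W.
Proof.
move=> cW; have [d d0 hd] := uniform_step cW.
(* Chosen so that the step length [b / (n + 1)] is below [d]. *)
pose n := Num.bound (b / d).
have nd : b < n.+1%:R * d.
  rewrite -ltr_pdivrMr//; apply: lt_trans (archi_boundP _) _.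
    by rewrite divr_ge0// ltW.
  by rewrite ltr_nat.
pose t i : R := b * i%:R / n.+1%:R.
have tb i : (i <= n.+1)%N -> 0 <= t i <= b.
  move=> le_in; rewrite /t divr_ge0 ?mulr_ge0//= ler_pdivrMr// ler_wpM2l//.
  by rewrite ler_nat.
have tS i : `|t i.+1 - t i| < d.
  rewrite /t -mulrBl -mulrBr -natrB// subSnn mulr1 ger0_norm ?divr_ge0//.
  by rewrite ltr_pdivrMr// mulrC.
have V_ex (x : X) : exists V, nbhs x V /\ forall i, (i <= n)%N ->
    exists z, forall y, V y -> W z (H (t i, y)) /\ W z (H (t i.+1, y)).
  suff [V xV hV] : exists2 V, nbhs x V & forall i, (i < n.+1)%N -> exists z,
    forall y, V y -> W z (H (t i, y)) /\ W z (H (t i.+1, y)) by exists V.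
  (* Intersect one neighbourhood per sampled time; radius [d] about [t m] also reaches [t m.+1]. *)
  have : (n.+1 <= n.+1)%N by [].
  elim: {-2}n.+1 => [_|m IH mn].
    by exists setT; [exact: filterT|move=> i; rewrite ltn0].
  have [V xV hV] := IH (ltnW mn).
  have [V' xV' [z hz]] := hd (t m) x (tb m (ltnW mn)).
  exists (V `&` V'); first exact: filterI.
  move=> i; rewrite ltnS leq_eqVlt => /predU1P[->|/hV[z' hz']]; last first.
    by exists z' => y [/hz'].
  by exists z => y [_ V'y]; split; apply: hz; rewrite ?subrr ?normr0.
have [V hV] := choice V_ex.
exists V, (fun i x => H (t i, x)), n; split; first by move=> x; have [] := hV x.
split.
- by move=> x y; rewrite /t mulr0 mul0r; exact: H0.
- by move=> x; rewrite /t mulfK// pnatr_eq0.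
- by move=> i z; have [_] := hV z; exact.
Qed.

End FineHomotopy.

Lemma null_homotopy_not_equivariant (R : realType) (X : topologicalType)
    (sigma : X -> X) (H : R * X -> X) (b : R) :
  [set: X] !=set0 -> compact_hausdorff X -> free_Z2_action sigma ->
  continuous H -> (0 <= b)%R -> (forall x y, H (0%R, x) = H (0%R, y)) ->
  ~ (forall x, H (b, sigma x) = sigma (H (b, x))).
Proof.
move=> [x _] cX free cH b0 H0 Hb; have [cs sK _] := free.
have [m [W [l [cW ol lm]]]] := exists_odd_labelling cX free.
apply: (no_odd_labelling cs sK x _ cW ol lm) => V cV.
exact: exists_fine_homotopy (proj1 cX) cH b0 H0 Hb _ cV.
Qed.

(** * From the suspension and the cone to homotopies *)

Section Clamp.
Variable R : realType.
Local Open Scope ring_scope.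

(** Retraction of the line onto [[0, 1/2]], giving homotopies defined at all real times. *)
Definition clamp (t : R) : R := Num.min (Num.max t 0) 2^-1.

Lemma clamp_half (t : R) : clamp t \in @half_itv R.
Proof.
apply/mem_set; rewrite /half_itv /= in_itv /= /clamp ge_min lexx orbT andbT.
by rewrite le_min le_max lexx orbT invr_ge0 ler0n.
Qed.

Lemma clamp_unit (t : R) : clamp t \in @unit_itv R.
Proof.
have := set_mem (clamp_half t); rewrite /half_itv /= in_itv /= => /andP[t0 t1].
apply/mem_set; rewrite /unit_itv /= in_itv /= t0 (le_trans t1)//.
by rewrite invf_le1// ler1n.
Qed.

Definition half_clamp (t : R) : @half_itv R := exist _ (clamp t) (clamp_half t).
Definition unit_clamp (t : R) : @unit_itv R := exist _ (clamp t) (clamp_unit t).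

Lemma clamp_continuous : continuous clamp.
Proof.
move=> t; apply: (@continuous_min R R (fun s => Num.max s 0) (fun=> 2^-1)).
  by apply: (@continuous_max R R id (fun=> 0)); [exact: cvg_id|exact: cvg_cst].
exact: cvg_cst.
Qed.

Lemma clamp0 : clamp 0 = 0.
Proof. by rewrite /clamp maxxx min_l// invr_ge0. Qed.

Lemma clamp_2V : clamp 2^-1 = 2^-1.
Proof. by rewrite /clamp max_l ?invr_ge0// minxx. Qed.

Lemma half_clamp_2V : half_clamp 2^-1 = @half_pt R.
Proof. by apply: val_inj; exact: clamp_2V. Qed.

Lemma half_clamp_continuous : continuous half_clamp.
Proof. by apply: continuous_comp_initial; exact: clamp_continuous. Qed.

Lemma unit_clamp_continuous : continuous unit_clamp.
Proof. by apply: continuous_comp_initial; exact: clamp_continuous. Qed.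

Lemma clamp_homotopy_continuous (X : topologicalType) (A : set R)
    (r : A * X -> A * X -> Prop) (k : R -> A) (f : gen_quot r -> X) :
  continuous k -> continuous f ->
  continuous (fun p : R * X => f (gen_class r (k p.1, p.2))).
Proof.
move=> ck /gen_quot_continuous cf p.
apply: (@continuous_comp _ _ _ (fun p : R * X => (k p.1, p.2))
  (f \o gen_class r)); last exact: cf.
case: p => t x S [[B C] /= [kB xC] BCS].
have tB : nbhs t (k @^-1` B) by exact: ck.
by exists (k @^-1` B, C) => // -[s y] /= [Bs Cy]; exact: BCS.
Qed.

End Clamp.

Theorem proposition2p1 (R : realType) (X : topologicalType) (sigma : X -> X)
    (X_neq0 : [set: X] !=set0)
    (X_compact : compact_hausdorff X)
    (X_findim : finite_covering_dim X)
    (sigma_free : free_Z2_action sigma) :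
  [/\ ~ (exists f : suspension R X -> X,
           continuous f /\ Z2_equivariant (susp_flip R sigma) sigma f),
      ~ (exists g : cone R X -> X,
           continuous g /\
           forall x, g (cone_base R (sigma x)) = sigma (g (cone_base R x)))
    & (exists f : suspension R X -> X,
         continuous f /\ Z2_equivariant (susp_flip R sigma) sigma f) <->
      (exists g : cone R X -> X,
         continuous g /\
         forall x, g (cone_base R (sigma x)) = sigma (g (cone_base R x)))].
Proof.
have half_ge0 : (0 <= 2^-1 :> R)%R by rewrite invr_ge0 ler0n.
have no_f : ~ (exists f : suspension R X -> X,
    continuous f /\ Z2_equivariant (susp_flip R sigma) sigma f).
  case=> f [cf fs].
  (* Half of the suspension suffices: time [0] is collapsed, and at [1/2] the flip acts as
     [sigma]. *)
  apply: (null_homotopy_not_equivariant X_neq0 X_compact sigma_free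
    (clamp_homotopy_continuous (@unit_clamp_continuous R) cf) half_ge0).
    move=> x y; congr f; apply/gen_class_eqP; apply: rst_step.
    by left; rewrite /= clamp0.
  move=> x; rewrite -fs; congr f; rewrite [RHS]susp_flipE.
  congr (susp_class _ _); apply: val_inj; rewrite /= clamp_2V.
  by rewrite [X in (X - _)%R]splitr mul1r addrK.
have no_g : ~ (exists g : cone R X -> X, continuous g /\
    forall x, g (cone_base R (sigma x)) = sigma (g (cone_base R x))).
  case=> g [cg gs].
  apply: (null_homotopy_not_equivariant X_neq0 X_compact sigma_free
    (clamp_homotopy_continuous (@half_clamp_continuous R) cg) half_ge0).
    move=> x y; congr g; apply/gen_class_eqP; apply: rst_step.
    by split; rewrite /= clamp0.
  by move=> x /=; rewrite half_clamp_2V; exact: gs.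
(* Both existence statements are refuted, hence equivalent. *)
by split.
Qed.
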